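(* Let $n\geqslant 3$ and $r$ be integers. If there exists an $r$-regular maximal $(2,3)$-antichain on $n$ points, then $r\geqslant \frac{5n-9}{6}$.
   Context: Let $[n]=\{1,2,\ldots,n\}$. A maximal $(2,3)$-antichain on $n$ points is a family $\mathcal{A}=\mathcal{A}_2\cup\mathcal{A}_3$ with $\mathcal{A}_2\subseteq\binom{[n]}{2}$ (2-element subsets) and $\mathcal{A}_3\subseteq\binom{[n]}{3}$ (3-element subsets) such that (1) no member of $\mathcal{A}$ is a subset of another member of $\mathcal{A}$, and (2) for every $X\in 2^{[n]}\setminus\mathcal{A}$ there is an $A\in\mathcal{A}$ with $X\subseteq A$ or $A\subseteq X$. It is $r$-regular if every element of $[n]$ is contained in exactly $r$ members of $\mathcal{A}$. *)

(* Defs.v *)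
From mathcomp Require Import all_boot all_order all_algebra.

Set Implicit Arguments.
Unset Strict Implicit.
Unset Printing Implicit Defensive.

(* The ground set [n] = {1, ..., n} is represented by 'I_n = {0, ..., n-1}. *)

(* F = F_2 :|: F_3, where F_k consists of k-element sets; either may be empty. *)
Definition two_three_family (n : nat) (F : {set {set 'I_n}}) : Prop :=
  forall A : {set 'I_n}, A \in F -> #|A| = 2 \/ #|A| = 3.

Definition antichain (n : nat) (F : {set {set 'I_n}}) : Prop :=
  forall A B : {set 'I_n}, A \in F -> B \in F -> A != B -> ~~ (A \subset B).

(* X ranges over all subsets of the ground set, of any size: maximality is among
   all antichains of the Boolean lattice, not only among (2,3)-antichains. *)
Definition saturated (n : nat) (F : {set {set 'I_n}}) : Prop :=
  forall X : {set 'I_n}, X \notin F ->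
    exists2 A : {set 'I_n}, A \in F & (X \subset A) || (A \subset X).

Definition maximal_23_antichain (n : nat) (F : {set {set 'I_n}}) : Prop :=
  [/\ two_three_family F, antichain F & saturated F].

Definition regular_family (n r : nat) (F : {set {set 'I_n}}) : Prop :=
  forall x : 'I_n, #|[set A in F | x \in A]| = r.

(* Main.v *)
Require Import Defs.
From mathcomp Require Import all_boot all_order all_algebra.
From mathcomp Require Import zify lra.
Import GRing.Theory Num.Theory.
Local Open Scope ring_scope.

(** Let G be the graph on the ground set whose edges are the pairs outside the
    antichain F.  By maximality the triples in F are exactly the triangles of G,
    and every edge of G lies in a triangle.  Write d(x) for the degree, w(xy) for
    the number of triangles on the edge xy and t(x) for the number of triangles
    at x, so that r = n - 1 - d(x) + t(x).  Summing w over the edges at x, each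
    of which contributes at least 1, gives w(xy) + d(x) - 1 <= 2 t(x).  For an
    arbitrary triangle xyz, add this bound for xy, yz and zx, and use
    d(x) + d(y) + d(z) - w(xy) - w(yz) - w(zx) <= |N(x) U N(y) U N(z)| <= n.
    If G has no edge then r >= n - 1. *)

Section NonMemberGraph.
Local Open Scope nat_scope.

Definition nonpair (n : nat) (F : {set {set 'I_n}}) (x y : 'I_n) : bool :=
  (x != y) && ([set x; y] \notin F).

Definition nbr (n : nat) (F : {set {set 'I_n}}) (x : 'I_n) : {set 'I_n} :=
  [set y | nonpair n F x y].

Definition triples_at (n : nat) (F : {set {set 'I_n}}) (x : 'I_n) :
    {set {set 'I_n}} :=
  [set A in F | (x \in A) && (#|A| == 3)].

Lemma nonpair_sym (n : nat) (F : {set {set 'I_n}}) : symmetric (nonpair n F).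
Proof. by move=> x y; rewrite /nonpair eq_sym setUC. Qed.

Lemma cards_triple (T : finType) (x y z : T) :
  x != y -> x != z -> y != z -> #|[set x; y; z]| = 3.
Proof.
by move=> xy xz yz; rewrite setUC cardsU1 !inE cards2 negb_or !(eq_sym z) xy xz yz.
Qed.

(** Inclusion-exclusion with the triple intersection dropped. *)
Lemma card_setU3_geq (T : finType) (A B C : {set T}) :
  #|A| + #|B| + #|C| <=
  #|A :|: B :|: C| + (#|A :&: B| + #|B :&: C| + #|C :&: A|).
Proof.
have h1 := cardsUI A B; have h2 := cardsUI (A :|: B) C.
have h3 : #|(A :|: B) :&: C| <= #|C :&: A| + #|B :&: C|.
  by rewrite setIUl (setIC A) -cardsUI leq_addr.
lia.
Qed.

Section Maximal.
Variables (n : nat) (F : {set {set 'I_n}}).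
Hypothesis maxF : maximal_23_antichain F.

(** Saturation gives a member comparable to the triangle. By size it is the triangle itself or a
    pair inside it, and all such pairs are edges of G, hence outside [F]. *)
Lemma triangle_in (x y z : 'I_n) :
  nonpair n F x y -> nonpair n F x z -> nonpair n F y z ->
  [set x; y; z] \in F.
Proof.
move=> xy xz yz; case: maxF => F23 _ satF.
have cX : #|[set x; y; z]| = 3.
  by case/andP: xy => ? _; case/andP: xz => ? _; case/andP: yz => ? _;
    exact: cards_triple.
apply: contraT => XF; have [A AF /orP[XA|AX]] := satF _ XF.
  have defX : [set x; y; z] = A.
    by apply/eqP; rewrite eqEcard XA cX; case: (F23 _ AF) => ->.
  by rewrite defX AF in XF.
case: (F23 _ AF) => cA; last first.
  have defX : A = [set x; y; z] by apply/eqP; rewrite eqEcard AX cX cA.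
  by rewrite -defX AF in XF.
have /cards2P[a [b [ab defA]]] : #|A| == 2 by rewrite cA.
suff : nonpair n F a b by rewrite /nonpair -defA AF andbF.
have : (a \in [set x; y; z]) /\ (b \in [set x; y; z]).
  by split; apply: (subsetP AX); rewrite defA !inE eqxx ?orbT.
(* Nine cases: the three with [a = b] contradict [ab], the others are given edges or their
   reversals. *)
rewrite !inE -!orbA; case=> /or3P[] /eqP ea /or3P[] /eqP eb; move: ab;
  rewrite ea eb ?eqxx //= => _; first [done | by rewrite nonpair_sym].
Qed.

(** A member comparable to the missing pair must be a triple above it. Its third point is a common
    neighbour, since a pair of [F] inside a triple of [F] would break the antichain condition. *)
Lemma nbr_common (x y : 'I_n) : y \in nbr n F x -> 0 < #|nbr n F x :&: nbr n F y|.
Proof.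
rewrite inE => xy; have /andP[nxy xyF] := xy.
case: maxF => F23 antiF satF; have [A AF /orP[XA|AX]] := satF _ xyF; last first.
  have defA : A = [set x; y].
    by apply/eqP; rewrite eqEcard AX cards2 nxy; case: (F23 _ AF) => ->.
  by rewrite -defA AF in xyF.
case: (F23 _ AF) => cA.
  have defA : [set x; y] = A by apply/eqP; rewrite eqEcard XA cards2 nxy cA.
  by rewrite defA AF in xyF.
have := cardsD A [set x; y].
rewrite (setIidPr XA) cards2 nxy cA => cD.
have /card_gt0P[u] : 0 < #|A :\: [set x; y]| by rewrite cD.
rewrite !inE negb_or => /andP[/andP[ux uy] uA].
have edge v : v \in A -> u != v -> nonpair n F v u.
  move=> vA uv; rewrite /nonpair eq_sym uv /=; apply: contraT; rewrite negbK => vuF.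
  have := antiF _ _ vuF AF; rewrite subUset !sub1set vA uA /=; apply.
  by apply/eqP=> e; move: cA; rewrite -e cards2; case: (_ != _).
apply/card_gt0P; exists u; rewrite !inE.
by rewrite !edge // (subsetP XA) // !inE eqxx ?orbT.
Qed.

Lemma codegree_leq (x y : 'I_n) : y \in nbr n F x ->
  #|nbr n F x :&: nbr n F y| <= #|[set A in triples_at n F x | y \in A]|.
Proof.
rewrite inE => xy; set W := _ :&: _.
have <- : #|[set [set x; y; u] | u in W]| = #|W|.
  apply: card_in_imset => u v; rewrite !inE => /andP[/andP[xu _] /andP[yu _]] _ e.
  have : u \in [set x; y; v] by rewrite -e !inE eqxx !orbT.
  by rewrite !inE !(eq_sym u) (negPf xu) (negPf yu) /= => /eqP.
apply: subset_leq_card; apply/subsetP => A /imsetP[u].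
rewrite !inE => /andP[xu yu] ->; rewrite triangle_in // !inE !eqxx ?orbT /= andbT.
by apply/eqP/cards_triple; [case/andP: xy | case/andP: xu | case/andP: yu].
Qed.

(** Double counting: a triple at [x] has only two points other than [x]. *)
Lemma sum_triples_at (x : 'I_n) :
  \sum_(z in nbr n F x) #|[set A in triples_at n F x | z \in A]| <=
  2 * #|triples_at n F x|.
Proof.
have -> : \sum_(z in nbr n F x) #|[set A in triples_at n F x | z \in A]| =
          \sum_(A in triples_at n F x) #|A :&: nbr n F x|.
  under eq_bigr => z _ do rewrite -sum1dep_card.
  rewrite (exchange_big_dep (mem (triples_at n F x))) /=; last by move=> ? ? ? /andP[].
  apply: eq_bigr => A AT; rewrite -sum1_card; apply: eq_bigl => z.
  by rewrite in_setI; move: AT => /= ->; rewrite andbC.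
rewrite mulnC -sum_nat_const; apply: leq_sum => A; rewrite inE => /and3P[_ xA /eqP cA].
have := cardsD1 x A; rewrite xA cA => -[->]; apply: subset_leq_card.
apply/subsetP => z; rewrite !inE => /andP[-> /andP[xz _]].
by rewrite eq_sym xz.
Qed.

(** In [sum_triples_at], the term of [y] is at least the codegree and each other neighbour
    contributes at least 1. *)
Lemma codegree_degree (x y : 'I_n) : y \in nbr n F x ->
  #|nbr n F x :&: nbr n F y| + #|nbr n F x| <= 2 * #|triples_at n F x| + 1.
Proof.
move=> yx; have := sum_triples_at x; rewrite (bigD1 y) //=.
have : #|nbr n F x :\ y| <=
    \sum_(z in nbr n F x | z != y) #|[set A in triples_at n F x | z \in A]|.
  rewrite -sum1_card (eq_bigl (fun z => (z \in nbr n F x) && (z != y))).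
    apply: leq_sum => z /andP[zx _].
    exact: leq_trans (nbr_common _ _ zx) (codegree_leq _ _ zx).
  by move=> z; rewrite !inE andbC.
have := codegree_leq _ _ yx; have := cardsD1 y (nbr n F x); rewrite yx add1n.
move=> -> hW hD hs; rewrite addn1 addnS ltnS.
exact: leq_trans (leq_add hW hD) hs.
Qed.

(** The members at [x] are triples or pairs, and the partners of [x] in pairs of [F] together with
    its neighbours partition the other [n - 1] points. *)
Lemma regular_degree (r : nat) (x : 'I_n) : regular_family r F ->
  r + #|nbr n F x| + 1 = n + #|triples_at n F x|.
Proof.
move=> /(_ x) <-; case: maxF => F23 _ _.
set P := [set y | (x != y) && ([set x; y] \in F)].
have -> : [set A in F | x \in A] = [set [set x; y] | y in P] :|: triples_at n F x.
  apply/setP => A; rewrite !inE; apply/andP/orP.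
    case=> AF xA; case: (F23 _ AF) => cA; last by right; rewrite AF xA cA.
    left; have := cardsD1 x A; rewrite xA cA => -[/esym/eqP/cards1P[y defy]].
    have defA : A = [set x; y] by rewrite -(setD1K xA) defy.
    apply/imsetP; exists y => //; rewrite inE -defA AF andbT eq_sym.
    have : y \in A :\ x by rewrite defy set11.
    by rewrite !inE => /andP[].
  case=> [/imsetP[y]|/and3P[-> ->]] //.
  by rewrite inE => /andP[_ yF] ->; rewrite yF !inE eqxx.
have disj : [set [set x; y] | y in P] :&: triples_at n F x = set0.
  apply/setP => A; rewrite !inE; apply/negP => /andP[/imsetP[y _ ->]].
  by rewrite cards2 => /and3P[_ _]; case: (_ != _).
have := cardsUI [set [set x; y] | y in P] (triples_at n F x).
rewrite disj cards0 addn0 => ->.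
have -> : #|[set [set x; y] | y in P]| = #|P|.
  apply: card_in_imset => u v; rewrite !inE => /andP[xu _] _ e.
  have : u \in [set x; v] by rewrite -e !inE eqxx orbT.
  by rewrite !inE eq_sym (negPf xu) => /eqP.
have := cardsC1 x; have := cardsUI P (nbr n F x).
have -> : P :|: nbr n F x = [set~ x].
  by apply/setP => y; rewrite !inE /nonpair eq_sym; case: (_ == _); case: (_ \in _).
have -> : P :&: nbr n F x = set0.
  by apply/setP => y; rewrite !inE /nonpair; case: (_ == _); case: (_ \in _).
(* The existence of [x] forces [n > 0], so the truncated [n.-1] is harmless. *)
have := ltn_ord x; rewrite cards0 card_ord addn0 => x_lt -> eN.
by rewrite (addnAC #|P|) eN addnAC addn1 prednK ?(leq_ltn_trans _ x_lt).
Qed.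

Lemma regular_maximal_leq (r : nat) : 0 < n -> regular_family r F ->
  5 * n <= 6 * r + 9.
Proof.
move=> n_gt0 regF; pose x : 'I_n := Ordinal n_gt0.
have [N0|/set0Pn[y yx]] := eqVneq (nbr n F x) set0.
  by have := regular_degree _ x regF; rewrite N0 cards0; lia.
have /card_gt0P[z /setIP[zx zy]] := nbr_common _ _ yx.
have xz : x \in nbr n F z by move: zx; rewrite !inE nonpair_sym.
have := card_setU3_geq _ (nbr n F x) (nbr n F y) (nbr n F z).
have := max_card (nbr n F x :|: nbr n F y :|: nbr n F z); rewrite card_ord.
(* The edges are oriented cyclically, so that each degree and each codegree occurs exactly once in
   the sum. *)
have := codegree_degree _ _ yx; have := codegree_degree _ _ zy.
have := codegree_degree _ _ xz.
have := regular_degree _ x regF; have := regular_degree _ y regF.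
have := regular_degree _ z regF.
lia.
Qed.

End Maximal.
End NonMemberGraph.

Theorem corollary2 (n r : nat) (hn : (3 <= n)%N)
  (hF : exists F : {set {set 'I_n}},
          maximal_23_antichain F /\ regular_family r F) :
  (5 * n%:Q - 9) / 6 <= r%:Q.
Proof.
have [F [maxF regF]] := hF.
have := regular_maximal_leq n F maxF r (ltnW (ltnW hn)) regF.
rewrite -(ler_nat rat) natrD !natrM => h.
have -> : n%:Q = n%:R by [].
have -> : r%:Q = r%:R by [].
lra.
Qed.
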